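(* Let $\varphi$ be a state on $\mathbb{C}\langle x_1,\ldots,x_d\rangle$ with a MOPS, $t>0$, and let $\varphi^{\uplus t}$ be the Boolean convolution power of $\varphi$. The coefficients in the recursion relation for the MOPS of $\varphi^{\uplus t}$ are the same as for $\varphi$, except that each $\mathcal{T}_i^{(0)}$ and $\mathcal{C}^{(1)}$ get multiplied by $t$.
   Context: A state on $\mathbb{C}\langle\mathbf{x}\rangle$ (polynomials in non-commuting self-adjoint $x_1,\ldots,x_d$) is a unital linear functional with $\varphi[P^*]=\overline{\varphi[P]}$, $\varphi[P^*P]\ge0$. A monic orthogonal polynomial system (MOPS) for $\varphi$ is a family $P_{\vec u}=x_{\vec u}+$ lower-order terms, $P_\emptyset=1$, indexed by multi-indices $\vec u\in\{1,\ldots,d\}^k$, $k\ge0$, with $\varphi[P_{\vec u}^*P_{\vec v}]=0$ for $\vec u\ne\vec v$. If $\varphi$ has a MOPS, then there are coefficients $B_{i,\vec w,\vec u}$, $\mathcal{C}_{\vec u}\ge0$ and a MOPS $\{P_{\vec u}\}$ such that $x_i=P_i+B_{i,\emptyset,\emptyset}$ and, for $|\vec u|=k\ge1$, $$x_iP_{\vec u}=P_{(i,\vec u)}+\sum_{|\vec w|=|\vec u|}B_{i,\vec w,\vec u}P_{\vec w}+\delta_{i,u(1)}\mathcal{C}_{\vec u}P_{(u(2),\ldots,u(k))}.$$ These coefficients are collected in the diagonal $d^k\times d^k$ matrices $\mathcal{C}^{(k)}$ ($k\ge1$) with diagonal entries $\mathcal{C}_{\vec u}$, $|\vec u|=k$,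 and the $d^k\times d^k$ matrices $\mathcal{T}_i^{(k)}$ ($k\ge0$) with $(\vec w,\vec u)$ entries $B_{i,\vec w,\vec u}$. In particular $\mathcal{T}_i^{(0)}=B_{i,\emptyset,\emptyset}$ is a scalar and $\mathcal{C}^{(1)}$ has diagonal entries $\mathcal{C}_1,\ldots,\mathcal{C}_d$. The matrices satisfy $(\mathcal{T}_i^{(k)})^*\mathcal{K}^{(k)}=\mathcal{K}^{(k)}\mathcal{T}_i^{(k)}$ with $\mathcal{K}^{(k)}=(I^{\otimes(k-1)}\otimes\mathcal{C}^{(1)})\cdots(I\otimes\mathcal{C}^{(k-1)})\mathcal{C}^{(k)}$. Boolean cumulant generating function: $\eta_\varphi(\mathbf{z})=1-(1+M_\varphi(\mathbf{z}))^{-1}$, where $M_\varphi(\mathbf{z})=\sum_{|\vec u|\ge1}\varphi[x_{\vec u}]z_{\vec u}$ in non-commuting indeterminates $\mathbf{z}$. $\varphi^{\uplus t}$ is the unital linear functional with $\eta_{\varphi^{\uplus t}}=t\,\eta_\varphi$. *)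

(* Defs.v *)
From HB Require Import structures.
From mathcomp Require Import all_boot all_order all_algebra.
From mathcomp Require Import finmap reals complex.
From mathcomp.multinomials Require Export monalg.

Set Implicit Arguments.
Unset Strict Implicit.
Unset Printing Implicit Defensive.

Import Order.TTheory GRing.Theory Num.Theory.

Local Open Scope ring_scope.
Local Open Scope complex_scope.

(* C<x_1, ..., x_d> is the monoid algebra of the free monoid on 'I_d; a
   multi-index u is a sequence (u(1), ..., u(k)) of elements of 'I_d. *)
Notation ncpoly R d := {malg (complex R)[{fmonom 'I_d}]}.

Section NCPoly.
Variables (R : realType) (d : nat).
Implicit Types (p : ncpoly R d) (u : seq 'I_d) (phi psi : {scalar ncpoly R d}).

Definition ncmon u : ncpoly R d := << FMonom u >>.

(* The antilinear anti-automorphism that fixes the variables. *)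
Definition ncstar p : ncpoly R d :=
  \sum_(w <- msupp p) << (p@_w)^* *g FMonom (rev w) >>.

Definition is_state phi :=
  [/\ phi 1 = 1,
      forall p, phi (ncstar p) = (phi p)^*
    & forall p, 0 <= phi (ncstar p * p)].

(* [mmeasure fdeg p] is deg p + 1, and 0 for p = 0: the lower-order terms of
   P u are those of degree less than |u|. *)
Definition is_MOPS phi (P : seq 'I_d -> ncpoly R d) :=
  [/\ P [::] = 1,
      forall u, (mmeasure (@fdeg _) (P u - ncmon u) <= size u)%N
    & forall u v, u != v -> phi (ncstar (P u) * P v) = 0].

Definition has_MOPS phi := exists P, is_MOPS phi P.

(* A square matrix of size d^k whose rows and columns are indexed by the
   multi-indices of length k. *)
Definition level_mx k := 'M[R[i]]_(#|{: k.-tuple 'I_d}|).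

Definition level_entry k (A : level_mx k) (w u : k.-tuple 'I_d) : R[i] :=
  A (enum_rank w) (enum_rank u).

(* T i k and C k stand for T_i^(k) (k >= 0) and C^(k) (k >= 1); C 0 is a dummy
   on which nothing depends. *)
Definition satisfies_recursion (P : seq 'I_d -> ncpoly R d)
    (T : 'I_d -> forall k, level_mx k) (C : forall k, level_mx k) :=
  (forall i, ncmon [:: i] =
     P [:: i] + (level_entry (T i 0%N) [tuple] [tuple])%:MP) /\
  (forall i k (u : k.+1.-tuple 'I_d),
     ncmon [:: i] * P u =
       P (i :: u)
       + \sum_(w : k.+1.-tuple 'I_d) level_entry (T i k.+1) w u *: P w
       + ((i == thead u)%:R * level_entry (C k.+1) u u) *: P (behead u)).

(* (T, C) are coefficients in the recursion relation for a MOPS of phi.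
   For a non-faithful phi they need not be unique. *)
Definition recursion_coefficients phi
    (T : 'I_d -> forall k, level_mx k) (C : forall k, level_mx k) :=
  (forall k, (0 < k)%N ->
     is_diag_mx (C k) /\
     forall u : k.-tuple 'I_d, 0 <= level_entry (C k) u u) /\
  exists2 P, is_MOPS phi P & satisfies_recursion P T C.

Definition scale_level k0 (t : R) (A : forall k, level_mx k) k : level_mx k :=
  if k == k0 then t%:C *: A k else A k.

End NCPoly.

Arguments ncmon {R d} u.

Section Series.
Variables (R : realType) (d : nat).

(* Formal power series in non-commuting indeterminates z_1, ..., z_d:
   F u is the coefficient of z_u = z_u(1) ... z_u(k). *)
Definition ncseries := seq 'I_d -> R[i].

Implicit Types (F G H : ncseries) (u w : seq 'I_d).

Definition ncs1 : ncseries := fun w => (w == [::])%:R.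

Definition ncs_add F G : ncseries := fun w => F w + G w.

Definition ncs_sub F G : ncseries := fun w => F w - G w.

Definition ncs_mul F G : ncseries := fun w =>
  \sum_(k < (size w).+1) F (take k w) * G (drop k w).

Definition ncs_exp F n : ncseries := iter n (ncs_mul F) ncs1.

(* The inverse of a series with constant term 1, by the geometric series
   (1 - N)^-1 = sum_n N^n with N = 1 - F; the powers n > |w| of N do not
   contribute to the coefficient of z_w. *)
Definition ncs_inv F : ncseries := fun w =>
  \sum_(n < (size w).+1) ncs_exp (ncs_sub ncs1 F) n w.

Lemma ncs_mul_nil F G : ncs_mul F G [::] = F [::] * G [::].
Proof. by rewrite /ncs_mul big_ord1. Qed.

Lemma ncs_mul_cons F G i w : ncs_mul F G (i :: w) =
  F [::] * G (i :: w) + ncs_mul (fun v => F (i :: v)) G w.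
Proof. by rewrite /ncs_mul /= big_ord_recl. Qed.

Lemma eq_ncs_mul F F' G G' : F =1 F' -> G =1 G' -> ncs_mul F G =1 ncs_mul F' G'.
Proof. by move=> eF eG w; apply: eq_bigr => k _; rewrite eF eG. Qed.

Lemma ncs_mul1l F : ncs_mul ncs1 F =1 F.
Proof.
move=> w; rewrite /ncs_mul big_ord_recl take0 drop0 /ncs1 eqxx mul1r.
rewrite big1 ?addr0 // => k _; case: w k => [[]//|i w] k /=.
by rewrite mul0r.
Qed.

Lemma ncs_mul1r F : ncs_mul F ncs1 =1 F.
Proof.
move=> w; elim: w F => [|i w IHw] F; first by rewrite ncs_mul_nil mulr1.
by rewrite ncs_mul_cons IHw /ncs1 /= mulr0 add0r.
Qed.

Lemma ncs_mulBl F G H :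
  ncs_mul (ncs_sub F G) H =1 ncs_sub (ncs_mul F H) (ncs_mul G H).
Proof.
move=> w; rewrite /ncs_sub /ncs_mul -sumrB.
by apply: eq_bigr => k _; rewrite mulrBl.
Qed.

Lemma ncs_mulA F G H :
  ncs_mul F (ncs_mul G H) =1 ncs_mul (ncs_mul F G) H.
Proof.
move=> w; elim: w F G => [|i w IHw] F G; first by rewrite !ncs_mul_nil mulrA.
rewrite ncs_mul_cons [RHS]ncs_mul_cons ncs_mul_cons ncs_mul_nil IHw mulrDr.
rewrite mulrA -addrA; congr (_ + _); rewrite /ncs_mul mulr_sumr -big_split /=.
apply: eq_bigr => k _.
by rewrite -/(ncs_mul F G) -/(ncs_mul F G (i :: _)) ncs_mul_cons mulrDl mulrA.
Qed.

Lemma ncs_exp_eq0 F n w : F [::] = 0 -> (size w < n)%N -> ncs_exp F n w = 0.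
Proof.
move=> F0; elim: n w => [|n IHn] w //=; rewrite ltnS => le_w_n.
rewrite /ncs_mul big_ord_recl take0 F0 mul0r add0r big1 // => k _.
case: w le_w_n k => [|i w] le_w_n k; first by case: k.
by rewrite [X in _ * X]IHn ?mulr0 //= size_drop (leq_ltn_trans (leq_subr _ _)).
Qed.

Lemma ncs_mul_invr F : F [::] = 1 -> ncs_mul F (ncs_inv F) =1 ncs1.
Proof.
move=> F1; set N := ncs_sub ncs1 F => w.
have N0 : N [::] = 0 by rewrite /N /ncs_sub /ncs1 eqxx F1 subrr.
have eF : F =1 ncs_sub ncs1 N by move=> v; rewrite /N /ncs_sub opprB addrC subrK.
have invE v : (size v <= size w)%N ->
    ncs_inv F v = \sum_(n < (size w).+1) ncs_exp N n v.
  move=> le_vw; rewrite /ncs_inv -/N -!(big_mkord xpredT (fun n => ncs_exp N n v)).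
  rewrite [RHS](@big_cat_nat _ _ _ (size v).+1) //= [X in _ + X]big1_seq ?addr0 //.
  move=> n; rewrite mem_index_iota => /andP[_ /andP[lt_vn _]].
  exact: ncs_exp_eq0.
rewrite (eq_ncs_mul eF (frefl _)) ncs_mulBl /ncs_sub ncs_mul1l.
have -> : ncs_mul N (ncs_inv F) w = \sum_(n < (size w).+1) ncs_exp N n.+1 w.
  rewrite /= /ncs_mul exchange_big /=; apply: eq_bigr => k _.
  by rewrite -mulr_sumr invE // size_drop leq_subr.
rewrite invE // big_ord_recl /= -addrA; set S := \sum_(_ < _) _.
rewrite big_ord_recr /= -/(ncs_exp N (size w).+1).
have -> : ncs_mul N (ncs_exp N (size w)) w = 0.
  exact: (@ncs_exp_eq0 N (size w).+1 w).
by rewrite addr0 subrr addr0.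
Qed.

Lemma ncs_inv_nil F : ncs_inv F [::] = 1.
Proof. by rewrite /ncs_inv big_ord1 /= /ncs1 eqxx. Qed.

Lemma ncs_invK F : F [::] = 1 -> ncs_inv (ncs_inv F) =1 F.
Proof.
move=> F1 w; rewrite -[LHS]ncs_mul1l.
rewrite (eq_ncs_mul (fsym (ncs_mul_invr F1)) (frefl _)) -ncs_mulA.
by rewrite (eq_ncs_mul (frefl _) (ncs_mul_invr (ncs_inv_nil F))) ncs_mul1r.
Qed.

Lemma ncs_mul_invl F : F [::] = 1 -> ncs_mul (ncs_inv F) F =1 ncs1.
Proof.
move=> F1 w; rewrite -(ncs_mul_invr (ncs_inv_nil F) w).
exact: (eq_ncs_mul (frefl _) (fsym (ncs_invK F1))).
Qed.

Lemma eq_ncs_inv F G : F =1 G -> ncs_inv F =1 ncs_inv G.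
Proof.
move=> eFG; have e n : ncs_exp (ncs_sub ncs1 F) n =1 ncs_exp (ncs_sub ncs1 G) n.
  elim: n => //= n IHn; apply: eq_ncs_mul => // v.
  by rewrite /ncs_sub eFG.
by move=> w; apply: eq_bigr => n _; apply: e.
Qed.

End Series.

Arguments ncs1 {R d} w.

Section BooleanPower.
Variables (R : realType) (d : nat).
Implicit Types (phi psi : {scalar ncpoly R d}).

Definition moment_series phi : ncseries R d :=
  fun u => if u is [::] then 0 else phi (ncmon u).

Definition boolean_cgf phi : ncseries R d :=
  ncs_sub ncs1
    (ncs_inv (ncs_add ncs1 (moment_series phi))).

(* psi is the t-th Boolean convolution power of phi. *)
Definition is_boolean_power phi (t : R) psi :=
  psi 1 = 1 /\ forall u, boolean_cgf psi u = t%:C * boolean_cgf phi u.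

Lemma ncmon0 : ncmon [::] = 1 :> ncpoly R d.
Proof. by apply/malgP => k; rewrite mcoeffU1 mcoeff1 !fmP fm1 eq_sym. Qed.

Lemma moment_series_nil phi :
  ncs_add ncs1 (moment_series phi) [::] = 1.
Proof. by rewrite /ncs_add /ncs1 eqxx addr0. Qed.

Lemma ncpolyE (p : ncpoly R d) : p = \sum_(w <- msupp p) p@_w *: ncmon w.
Proof.
rewrite [LHS]monalgE; apply: eq_bigr => w _.
by apply/malgP => v; rewrite mcoeffZ mcoeffU1 mcoeffU mulr_natr fmK.
Qed.

Lemma scalar_ext phi psi : (forall u, phi (ncmon u) = psi (ncmon u)) ->
  phi =1 psi.
Proof.
move=> e p; rewrite (ncpolyE p) !linear_sum; apply: eq_bigr => w _.
by rewrite !linearZ /= e.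
Qed.

Lemma scalar_exists (m : ncseries R d) :
  exists phi, forall u, phi (ncmon u) = m u.
Proof.
pose f (p : ncpoly R d) : R[i] := \sum_(w <- msupp p) p@_w * m w.
have fE (D : {fset {fmonom 'I_d}}) p : (msupp p `<=` D)%fset ->
    f p = \sum_(w <- D) p@_w * m w.
  move=> le; rewrite [LHS](big_fset_incl _ le) //= => w _ /mcoeff_outdom ->.
  by rewrite mul0r.
have f_lin : scalar f.
  move=> a p q; pose D := (msupp p `|` msupp q `|` msupp (a *: p + q))%fset.
  rewrite (fE D) ?fsubsetUr // (fE D p) ?(fE D q).
  - rewrite mulr_sumr -big_split; apply: eq_bigr => w _ /=.
    by rewrite mcoeffD mcoeffZ mulrDl mulrA.
  - by apply/fsubsetP => w wq; rewrite !in_fsetU wq !orbT.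
  - by apply/fsubsetP => w wp; rewrite !in_fsetU wp.
pose L := GRing.isLinear.Build R[i] (ncpoly R d) R[i] *%R f f_lin.
pose phi : {scalar ncpoly R d} := HB.pack f L.
by exists phi => u; rewrite /= /f msuppU1 big_seq_fset1 mcoeffU1 eqxx mul1r.
Qed.

Lemma boolean_power_exists phi t : exists psi, is_boolean_power phi t psi.
Proof.
pose eta : ncseries R d := fun u => t%:C * boolean_cgf phi u.
have eta0 : eta [::] = 0.
  by rewrite /eta /boolean_cgf /ncs_sub ncs_inv_nil /ncs1 eqxx subrr mulr0.
pose G := ncs_sub ncs1 eta.
have G0 : G [::] = 1 by rewrite /G /ncs_sub eta0 /ncs1 eqxx subr0.
have [psi psiE] := scalar_exists (ncs_inv G).
have eM : ncs_add ncs1 (moment_series psi) =1 ncs_inv G.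
  case=> [|i u]; first by rewrite moment_series_nil ncs_inv_nil.
  by rewrite /ncs_add /ncs1 /= add0r psiE.
exists psi; split=> [|u]; first by rewrite -ncmon0 psiE ncs_inv_nil.
by rewrite /boolean_cgf /ncs_sub (eq_ncs_inv eM) ncs_invK // /G /ncs_sub subKr.
Qed.

Lemma boolean_power_unique phi t psi1 psi2 :
  is_boolean_power phi t psi1 -> is_boolean_power phi t psi2 -> psi1 =1 psi2.
Proof.
move=> [u1 e1] [u2 e2]; apply: scalar_ext => u.
have eI : ncs_inv (ncs_add ncs1 (moment_series psi1)) =1
          ncs_inv (ncs_add ncs1 (moment_series psi2)).
  move=> w; have := e1 w; rewrite -(e2 w) /boolean_cgf /ncs_sub.
  by move/addrI/oppr_inj.
case: u => [|i u]; first by rewrite ncmon0 u1 u2.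
have := eq_ncs_inv eI (i :: u).
rewrite !ncs_invK ?moment_series_nil //.
by rewrite /ncs_add => /addrI.
Qed.

End BooleanPower.

(* Main.v *)
From HB Require Import structures.
Require Import Defs.
From mathcomp Require Import all_boot all_order all_algebra.
From mathcomp Require Import finmap reals complex.
From mathcomp Require Import ring.

Set Implicit Arguments.
Unset Strict Implicit.
Unset Printing Implicit Defensive.

Import Order.TTheory GRing.Theory Num.Theory.

Local Open Scope ring_scope.

(** Put M = M_phi and N = M_psi for psi the t-th Boolean power of phi. Since
    eta_psi = t eta_phi reads (1 + N)^-1 = (1 - t) + t (1 + M)^-1, one gets
      1 + M = (1 + N) (t + (1 - t) (1 + M)).
    The right factor suggests the linear map T on polynomials
      T x_w = t x_w + (1 - t) sum_(w = u v) phi(x_v) x_u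
    (word concatenation), and the identity says that psi (T p) = phi p.
    The term v = empty contributes (1 - t) x_w because phi 1 = 1, so T x_w is
    x_w plus terms of lower degree.

    The map T carries everything from phi to psi. Splitting off u = empty
    shows that T almost commutes with multiplication by a variable:
      x_i (T p) = T (x_i p) + (t - 1) phi(x_i p) 1          [mul_var_transfer].
    As the variables are self-adjoint, induction on p turns this into
      psi((T p)^* (T q)) = t phi(p^* q) + (1 - t) phi(p)^* phi(q)
                                                            [transfer_gram].
    Three consequences follow.
    - T is onto, and the right-hand side for q = p is
      t (phi(p^* p) - |phi p|^2) + |phi p|^2, which is nonnegative by the
      Cauchy-Schwarz inequality: psi is a state.
    - If P is a MOPS for phi, then phi (P u) = 0 for u nonempty, so the
      right-hand side vanishes at distinct P u and P v: the T (P u) form a MOPS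
      for psi.
    - Apply T to the recursion for x_i (P u). By mul_var_transfer the only
      change is the extra constant (t - 1) phi(x_i (P u)), and phi kills every
      term of the recursion except the multiple of P empty. There is such a
      term only when u is empty, with coefficient T_i^(0), or when |u| = 1,
      with coefficient taken from C^(1); these two get multiplied by t.

    Since phi is the t^-1-th Boolean power of psi, the converse implication
    between the recursions is the same statement for psi and t^-1. *)

(** * Polynomials over a monoid of monomials *)

Lemma malg_scalerAr (K : monomType) (F : comRingType) (c : F)
  (p q : {malg F[K]}) : p * (c *: q) = c *: (p * q).
Proof.
apply/malgP => v; rewrite mcoeffZ.
rewrite (mcoeffMlw _ (fsubset_refl (msupp p)) (msuppZ_le c q)).
rewrite mcoeffMl mulr_sumr; apply: eq_bigr => k1 _.
rewrite mulr_sumr; apply: eq_bigr => k2 _.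
by rewrite mcoeffZ mulrCA mulrnAr.
Qed.

Lemma malgUM (K : monomType) (F : comRingType) (k1 k2 : K) :
  << k1 >> * << k2 >> = << mmul k1 k2 >> :> {malg F[K]}.
Proof. by rewrite malgM_def fgmulUU mulr1. Qed.

(** Covers the involution of the free algebra: f is the conjugation of
    coefficients and s the reversal of words. *)
Lemma mcoeff_reindex (K : choiceType) (F : zmodType) (f : F -> F)
    (s : K -> K) (p : {malg F[K]}) v :
  f 0 = 0 -> involutive s ->
  (\sum_(w <- msupp p) << f p@_w *g s w >>)@_v = f p@_(s v).
Proof.
move=> f0 sK; rewrite raddf_sum /=.
under eq_bigr => w _ do rewrite mcoeffU (can2_eq sK sK).
have [vp|/mcoeff_outdom p0] := boolP (s v \in msupp p).
  rewrite (big_fsetD1 _ vp) eqxx /= big1_fset ?addr0 // => w.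
  by rewrite !inE => /andP[/negPf-> _] _.
rewrite big1_seq ?p0 // => w /andP[_ wp]; case: eqP => [ew|//].
by rewrite ew p0.
Qed.

Lemma malg_linear_ext (K : choiceType) (F : comNzRingType) (V : lmodType F)
    (h : K -> V) :
  exists T : {linear {malg F[K]} -> V}, forall k, T << k >> = h k.
Proof.
pose f (p : {malg F[K]}) : V := \sum_(k <- msupp p) p@_k *: h k.
have fE (D : {fset K}) p : (msupp p `<=` D)%fset ->
    f p = \sum_(k <- D) p@_k *: h k.
  move=> le; rewrite [LHS](big_fset_incl _ le) //= => k _ /mcoeff_outdom ->.
  by rewrite scale0r.
have f_lin : linear f.
  move=> c p q; pose D := (msupp p `|` msupp q `|` msupp (c *: p + q))%fset.
  rewrite (fE D) ?fsubsetUr // (fE D p) ?(fE D q).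
  - rewrite scaler_sumr -big_split; apply: eq_bigr => k _ /=.
    by rewrite mcoeffD mcoeffZ scalerDl scalerA.
  - by apply/fsubsetP => k kq; rewrite !in_fsetU kq !orbT.
  - by apply/fsubsetP => k kp; rewrite !in_fsetU kp.
pose L := GRing.isLinear.Build F {malg F[K]} V *:%R f f_lin.
pose T : {linear {malg F[K]} -> V} := HB.pack f L.
by exists T => k; rewrite /= /f msuppU oner_eq0 big_seq_fset1 mcoeffUU scale1r.
Qed.

Lemma malgCE (K : monomType) (F : comNzRingType) (c : F) :
  c%:MP = c *: 1 :> {malg F[K]}.
Proof. by rewrite -mul_malgC mulr1. Qed.

Section Measure.
Variables (K : monomType) (F : comNzRingType) (mf : measure K).
Implicit Types p q : {malg F[K]}.

Lemma mmeasure_leP p n :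
  reflect (forall k, (n <= mf k)%N -> p@_k = 0) (mmeasure mf p <= n)%N.
Proof.
apply: (iffP idP) => [le_pn k le_nk|p0].
  by apply/mcoeff_outdom/mmeasure_mnm_ge/(leq_trans le_pn).
rewrite mmeasureE; apply/bigmax_leqP_seq => k kp _; rewrite ltnNge.
by apply/negP => /p0 /eqP; rewrite mcoeff_eq0 kp.
Qed.

(** A linear map that alters each monomial only in lower degree keeps the
    leading term of a polynomial: the monomials of p other than k0 have degree
    below that of k0, so their images cannot reach it. *)
Lemma mmeasure_lead (T : {linear {malg F[K]} -> {malg F[K]}}) k0 p :
  (forall k, (mmeasure mf (T << k >> - << k >>)%R <= mf k)%N) ->
  (mmeasure mf (p - << k0 >>) <= mf k0)%N ->
  (mmeasure mf (T p - << k0 >>) <= mf k0)%N.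
Proof.
move=> T_lead /mmeasure_leP p_lead; apply/mmeasure_leP => k le_k.
have pE : p = \sum_(j <- msupp p) p@_j *: << j >>.
  rewrite [LHS]monalgE; apply: eq_bigr => j _; apply/malgP => i.
  by rewrite mcoeffZ mcoeffU1 mcoeffU mulr_natr.
have Tp : (T p - p)@_k = 0.
  rewrite {1 2}pE linear_sum -sumrB raddf_sum big1_seq // => j /andP[_ jp].
  rewrite linearZ -scalerBr /= mcoeffZ; case: (ltnP (mf k0) (mf j)) => [lt_j|le_j].
    have := p_lead j (ltnW lt_j); rewrite mcoeffB mcoeffU1.
    case: eqP lt_j => [->|_ _]; first by rewrite ltnn.
    by rewrite subr0 => ->; rewrite mul0r.
  have /mmeasure_leP-> := T_lead j; first by rewrite mulr0.
  exact: leq_trans le_k.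
by rewrite -[T p](subrK p) -addrA mcoeffD Tp p_lead ?addr0.
Qed.

Lemma mmeasure_sum_lt (J : finType) (a : F) (b : J -> F) (k : J -> K) n :
  (forall j, mf (k j) < n)%N ->
  (mmeasure mf (a *: \sum_j b j *: << k j >>)%R <= n)%N.
Proof.
move=> lt_n; apply/mmeasure_leP => m le_m.
rewrite mcoeffZ raddf_sum big1 ?mulr0 // => j _ /=; rewrite mcoeffZ mcoeffU1.
by case: eqP (lt_n j) => [->|_ _]; rewrite ?mulr0 // ltnNge le_m.
Qed.

End Measure.

(** * Transfer along a Boolean power, in an algebra spanned by words *)

Section StarWordAlgebra.
Variables (F : numClosedFieldType) (I : Type) (A : lalgType F).
Variables (word : seq I -> A) (star : A -> A).
Implicit Types (p q : A) (u w : seq I) (a c : F).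

(** The features of the free algebra on which the transfer argument rests: A is
    an algebra spanned by the words in self-adjoint generators. *)
Record star_word_algebra : Prop := StarWordAlgebra {
  word0 : word [::] = 1;
  wordM : forall u w, word u * word w = word (u ++ w);
  word_ind : forall Q : A -> Prop, (forall p q, Q p -> Q q -> Q (p + q)) ->
    (forall c w, Q (c *: word w)) -> forall p, Q p;
  word_scalerAr : forall c p q, p * (c *: q) = c *: (p * q);
  starD : forall p q, star (p + q) = star p + star q;
  starZ : forall c p, star (c *: p) = c^* *: star p;
  star_word : forall w, star (word w) = word (rev w) }.

Hypothesis As : star_word_algebra.

Lemma star1 : star 1 = 1.
Proof. by rewrite -(word0 As) (star_word As). Qed.

Lemma star_mul_var i p : star (word [:: i] * p) = star p * word [:: i].
Proof.
elim/(word_ind As): p => [p q IHp IHq|c w].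
  by rewrite mulrDr !(starD As) IHp IHq mulrDl.
rewrite (word_scalerAr As) !(starZ As) (wordM As) !(star_word As) -scalerAl.
by rewrite (wordM As) rev_cons cats1.
Qed.

(** The Cauchy-Schwarz inequality against 1, from the positivity of phi at
    p - phi(p) 1. *)
Lemma state_cauchy_schwarz1 (phi : {scalar A}) p :
  phi 1 = 1 -> (forall p, phi (star p) = (phi p)^*) ->
  (forall p, 0 <= phi (star p * p)) ->
  (phi p)^* * phi p <= phi (star p * p).
Proof.
move=> phi1 phi_star phi_ge0; have := phi_ge0 (p + (- phi p) *: 1).
rewrite (starD As) (starZ As) star1 mulrDl !mulrDr !(word_scalerAr As) !mulr1.
rewrite -scalerAl mul1r !linearD /= !linearZ /= phi_star phi1 rmorphN mulr1.
suff -> : phi (star p * p) + - phi p * (phi p)^* +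
   (- (phi p)^* * phi p + - phi p * (- (phi p)^*)) =
   phi (star p * p) - (phi p)^* * phi p by rewrite subr_ge0.
ring.
Qed.

(** Dual to right multiplication of series by t + (1 - t) (1 + M_phi): for any
    linear psi, the coefficient of z_w in (1 + M_psi) (t + (1 - t) (1 + M_phi))
    is psi (T x_w). *)
Definition is_transfer (t : F) (phi : A -> F) (T : A -> A) := forall w,
  T (word w) = t *: word w +
  (1 - t) *: \sum_(k < (size w).+1) phi (word (drop k w)) *: word (take k w).

Section Transfer.
Variables (t : F) (phi psi : {scalar A}) (T : {linear A -> A}).
Hypothesis T_word : is_transfer t phi T.
Hypothesis phi1 : phi 1 = 1.

(** The cut that leaves an empty prefix of i w is the only one that is not a
    cut of w; it accounts for the constant. *)
Lemma mul_var_transfer i p : word [:: i] * T p =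
  T (word [:: i] * p) + ((t - 1) * phi (word [:: i] * p)) *: 1.
Proof.
elim/(word_ind As): p => [p q IHp IHq|c w].
  by rewrite mulrDr !linearD mulrDr IHp IHq /= mulrDr scalerDl addrACA.
rewrite linearZ /= !(word_scalerAr As) !linearZ /= mulrCA -scalerA -scalerDr.
congr (_ *: _); rewrite (wordM As) /= !T_word [in RHS]big_ord_recl /=.
rewrite mulrDr !(word_scalerAr As) (wordM As) /= (word0 As) -addrA.
congr (_ + _); rewrite -[t - 1]opprB mulNr scaleNr -scalerA -scalerBr.
rewrite addrAC subrr add0r; congr (_ *: _); rewrite mulr_sumr.
by apply: eq_bigr => k _; rewrite (word_scalerAr As) (wordM As).
Qed.

Lemma transfer1 : T 1 = 1.
Proof.
rewrite -(word0 As) T_word big_ord1 /= (word0 As) phi1 scale1r.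
by rewrite -scalerDl addrC subrK scale1r.
Qed.

Lemma transfer_word_lead w : T (word w) - word w =
  (1 - t) *: \sum_(k < size w) phi (word (drop k w)) *: word (take k w).
Proof.
rewrite T_word big_ord_recr /= drop_size take_size (word0 As) phi1 scale1r.
by rewrite scalerDr addrCA -scalerDl addrC addrC [t + _]addrC subrK scale1r addrK.
Qed.

(** By mul_var_transfer and T 1 = 1, the image of T contains 1 and is stable
    under multiplication by the variables. *)
Lemma transfer_surj p : exists q, p = T q.
Proof.
elim/(word_ind As): p => [p q [p' ->] [q' ->]|c w].
  by exists (p' + q'); rewrite linearD.
suff [q ->] : exists q, word w = T q by exists (c *: q); rewrite linearZ.
elim: w => [|i w [q eq_q]]; first by exists 1; rewrite transfer1 (word0 As).
exists (word [:: i] * q + ((t - 1) * phi (word [:: i] * q)) *: 1).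
by rewrite linearD linearZ /= transfer1 -mul_var_transfer -eq_q (wordM As).
Qed.

Hypothesis t_gt0 : 0 < t.
Hypothesis phi_star : forall p, phi (star p) = (phi p)^*.
(** The identity 1 + M_phi = (1 + M_psi) (t + (1 - t) (1 + M_phi)). *)
Hypothesis psi_moments : forall w, phi (word w) = t * psi (word w) +
  (1 - t) * \sum_(k < (size w).+1) psi (word (take k w)) * phi (word (drop k w)).

Lemma psi_transfer p : psi (T p) = phi p.
Proof.
elim/(word_ind As): p => [p q IHp IHq|c w]; first by rewrite !linearD IHp IHq.
rewrite !linearZ /= T_word psi_moments linearD !linearZ /= linear_sum.
by congr (_ * (_ + _ * _)); apply: eq_bigr => k _; rewrite linearZ mulrC.
Qed.

(** Both sides are antilinear in p, so p may be taken to be a word. Removing its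
    first letter i moves x_i, which is self-adjoint, from T p to T q at the
    price of two constants, and their contributions are the change in the
    product of the two means. *)
Lemma transfer_gram p q : psi (star (T p) * T q) =
  t * phi (star p * q) + (1 - t) * ((phi p)^* * phi q).
Proof.
have t_conj : t^* = t by rewrite conj_Creal ?gtr0_real.
elim/(word_ind As): p => [p p' IHp IHp'|c w].
  rewrite !linearD /= !(starD As) !mulrDl !linearD /= IHp IHp' rmorphD; ring.
rewrite !linearZ /= !(starZ As) -!scalerAl !linearZ /= rmorphM /=.
suff -> : psi (star (T (word w)) * T q) =
  t * phi (star (word w) * q) + (1 - t) * ((phi (word w))^* * phi q) by ring.
elim: w q => [|i w IHw] q.
  by rewrite (word0 As) transfer1 star1 !mul1r psi_transfer phi1 rmorph1; ring.
have T_wi : T (word (i :: w)) =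
    word [:: i] * T (word w) - ((t - 1) * phi (word (i :: w))) *: 1.
  by rewrite mul_var_transfer (wordM As) addrK.
have psi_Tw : psi (star (T (word w))) = (phi (word w))^*.
  have := IHw 1; rewrite transfer1 !mulr1 phi1 phi_star => ->; ring.
rewrite T_wi -scaleNr (starD As) star_mul_var (starZ As) star1 mulrDl -mulrA.
rewrite mul_var_transfer mulrDr (word_scalerAr As) mulr1 -scalerAl mul1r.
rewrite !linearD /= !linearZ /= IHw psi_Tw psi_transfer -[i :: w]cat1s.
rewrite -(wordM As) star_mul_var mulrA.
rewrite rmorphN rmorphM rmorphB rmorph1 /= t_conj.
ring.
Qed.

(** Every polynomial is some T q, and psi((T q)^* (T q)) is t times the variance
    of q under phi plus the squared modulus of phi q. *)
Lemma transfer_state : (forall p, 0 <= phi (star p * p)) ->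
  [/\ psi 1 = 1, forall p, psi (star p) = (psi p)^*
    & forall p, 0 <= psi (star p * p)].
Proof.
move=> phi_ge0; split=> [|p|p].
- by rewrite -transfer1 psi_transfer.
- have [q ->] := transfer_surj p.
  have := transfer_gram q 1; rewrite transfer1 !mulr1 phi1 phi_star psi_transfer.
  by move=> ->; ring.
- have [q ->] := transfer_surj p; rewrite transfer_gram.
  have -> : t * phi (star q * q) + (1 - t) * ((phi q)^* * phi q) =
    t * (phi (star q * q) - (phi q)^* * phi q) + phi q * (phi q)^* by ring.
  by rewrite addr_ge0 ?mul_conjC_ge0 // mulr_ge0 ?(ltW t_gt0) // subr_ge0
     state_cauchy_schwarz1.
Qed.

Section Orthogonal.
Variable P : seq I -> A.
Hypothesis P0 : P [::] = 1.

Hypothesis P_orth : forall u v, u <> v -> phi (star (P u) * P v) = 0.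

(** P empty is 1, so orthogonality to it says that P u has mean zero. *)
Lemma phi_orthogonal i u : phi (P (i :: u)) = 0.
Proof. by rewrite -[P _]mul1r -star1 -P0 P_orth. Qed.

Lemma transfer_orthogonal u v : u <> v -> psi (star (T (P u)) * T (P v)) = 0.
Proof.
move=> neq_uv; rewrite transfer_gram P_orth // mulr0 add0r.
case: u v neq_uv => [|i u] [|j v] neq_uv //; rewrite ?phi_orthogonal ?rmorph0;
by rewrite ?mul0r !mulr0.
Qed.

(** Here phi x_i = b, so the scalar b of the recursion grows by (t - 1) b. *)
Lemma transfer_recursion0 i b : word [:: i] = P [:: i] + b *: 1 ->
  word [:: i] = T (P [:: i]) + (t * b) *: 1.
Proof.
move=> rec_i; have := mul_var_transfer i 1; rewrite transfer1 !mulr1 => ->.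
rewrite rec_i !linearD !linearZ /= transfer1 phi1 phi_orthogonal.
by rewrite -addrA -scalerDl; congr (_ + _ *: _); ring.
Qed.

(** The mean of x_i P(j u) under phi is c phi (P u), which is c if u is empty and
    0 otherwise; hence c is multiplied by t exactly in the first case. *)
Lemma transfer_recursion (W : finType) (b : W -> F) (v : W -> seq I) i j u c :
  (forall x, exists k s, v x = k :: s) ->
  word [:: i] * P (j :: u) =
    P [:: i, j & u] + \sum_x b x *: P (v x) + c *: P u ->
  word [:: i] * T (P (j :: u)) =
    T (P [:: i, j & u]) + \sum_x b x *: T (P (v x)) +
    ((if u is [::] then t else 1) * c) *: T (P u).
Proof.
move=> v_neq0 rec_u; rewrite mul_var_transfer.
have -> : phi (word [:: i] * P (j :: u)) = c * phi (P u).
  rewrite rec_u !linearD linearZ /= phi_orthogonal linear_sum big1 ?add0r // => x _.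
  by have [k [s ->]] := v_neq0 x; rewrite linearZ /= phi_orthogonal mulr0.
rewrite rec_u !linearD linear_sum linearZ /= -addrA; congr (_ + _ + _).
  by apply: eq_bigr => x _; rewrite linearZ.
case: u {rec_u} => [|k u]; last by rewrite phi_orthogonal !mulr0 scale0r addr0 mul1r.
by rewrite P0 transfer1 phi1 -scalerDl; congr (_ *: _); ring.
Qed.

End Orthogonal.
End Transfer.
End StarWordAlgebra.

(** * Non-commutative polynomials *)

Section NCPoly.
Variables (R : realType) (d : nat).
Implicit Types (p q : ncpoly R d) (u w : seq 'I_d) (c : R[i]).

Lemma ncpoly_ind (Q : ncpoly R d -> Prop) :
  (forall p q, Q p -> Q q -> Q (p + q)) ->
  (forall c w, Q (c *: ncmon w)) -> forall p, Q p.
Proof.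
move=> QD QZ p; rewrite (ncpolyE p); apply: big_ind => //.
rewrite -(scale0r (ncmon [::])); exact: QZ.
Qed.

Lemma ncmonM u w : ncmon u * ncmon w = ncmon (u ++ w) :> ncpoly R d.
Proof.
by rewrite /ncmon malgUM; congr << _ >>; apply/eqP; rewrite fmP fmM.
Qed.

Lemma mcoeff_ncstar p (v : {fmonom 'I_d}) :
  (ncstar p)@_v = (p@_(FMonom (rev v)))^*.
Proof.
apply: (@mcoeff_reindex _ _ Num.conj (fun w : {fmonom 'I_d} => FMonom (rev w))).
  exact: rmorph0.
by move=> w; apply/eqP; rewrite fmP /= revK.
Qed.

Lemma ncstarD : {morph @ncstar R d : p q / p + q}.
Proof.
move=> p q; apply/malgP => v.
rewrite (mcoeff_ncstar (p + q)) !mcoeffD.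
rewrite (mcoeff_ncstar p) (mcoeff_ncstar q).
exact: rmorphD.
Qed.

Lemma ncstarZ c p : ncstar (c *: p) = c^* *: ncstar p.
Proof.
apply/malgP => v.
rewrite (mcoeff_ncstar (c *: p)) !mcoeffZ (mcoeff_ncstar p).
exact: rmorphM.
Qed.

Lemma ncstar_ncmon w : ncstar (ncmon w : ncpoly R d) = ncmon (rev w).
Proof.
apply/malgP => v; rewrite mcoeff_ncstar !mcoeffU1 rmorph_nat.
by rewrite !fmP /= (can2_eq revK revK).
Qed.

Lemma ncpoly_star_word_algebra :
  star_word_algebra (A := ncpoly R d) ncmon (@ncstar R d).
Proof.
split.
- exact: ncmon0.
- exact: ncmonM.
- exact: ncpoly_ind.
- exact: malg_scalerAr.
- exact: ncstarD.
- exact: ncstarZ.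
- exact: ncstar_ncmon.
Qed.
End NCPoly.

(** * Boolean powers of functionals *)

Section BooleanPowerMoments.
Variables (R : realType) (d : nat) (t : R) (phi psi : {scalar ncpoly R d}).
Local Notation tC := (t%:C)%C.

Lemma moment_seriesE (theta : {scalar ncpoly R d}) : theta 1 = 1 ->
  ncs_add ncs1 (moment_series theta) =1 fun w => theta (ncmon w).
Proof.
move=> theta1 [|i w]; first by rewrite moment_series_nil ncmon0 theta1.
by rewrite /ncs_add /ncs1 /= add0r.
Qed.

(** With M and N the full moment series of phi and psi, the relation between the
    cumulants is N^-1 = (1 - t) + t M^-1; multiply it by N on the left and by M
    on the right. *)
Lemma boolean_power_moments w : phi 1 = 1 -> is_boolean_power phi t psi ->
  phi (ncmon w) = tC * psi (ncmon w) + (1 - tC) *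
    \sum_(k < (size w).+1) psi (ncmon (take k w)) * phi (ncmon (drop k w)).
Proof.
move=> phi1 [psi1 eta_psi].
rewrite -(moment_seriesE phi1) -(moment_seriesE psi1).
under eq_bigr => k _ do rewrite -(moment_seriesE phi1) -(moment_seriesE psi1).
have := moment_series_nil psi; have := moment_series_nil phi.
move: eta_psi; rewrite /boolean_cgf.
set M := ncs_add _ (moment_series phi); set N := ncs_add _ (moment_series psi).
move=> eta_psi M0 N0; rewrite -/(ncs_mul N M w).
have inv_N v : ncs_inv N v = (1 - tC) * ncs1 v + tC * ncs_inv M v.
  apply: (addrI (- ncs1 v)); apply: oppr_inj.
  have := eta_psi v; rewrite /ncs_sub opprD opprK => ->; ring.
have inv_N_M v : ncs_mul (ncs_inv N) M v = (1 - tC) * M v + tC * ncs1 v.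
  rewrite -(ncs_mul_invl M0 v) -[in (1 - tC) * _](ncs_mul1l M v) /ncs_mul.
  rewrite !mulr_sumr -big_split; apply: eq_bigr => k _ /=.
  by rewrite inv_N; ring.
rewrite -[LHS]ncs_mul1l -(eq_ncs_mul (ncs_mul_invr N0) (frefl M) w) -ncs_mulA.
rewrite (eq_ncs_mul (frefl N) inv_N_M w) -(ncs_mul1r N w) /ncs_mul.
rewrite !mulr_sumr -big_split; apply: eq_bigr => k _ /=.
ring.
Qed.
End BooleanPowerMoments.

Lemma level_entry_scale (R : realType) (d : nat) (t : R) k0
    (D : forall k, level_mx R d k) k (w u : k.-tuple 'I_d) :
  level_entry (scale_level k0 t D k) w u =
  (if k == k0 then (t%:C)%C else 1) * level_entry (D k) w u.
Proof.
by rewrite /level_entry /scale_level; case: (k == k0); rewrite ?mxE ?mul1r.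
Qed.

Section BooleanPowerMOPS.
Variables (R : realType) (d : nat) (t : R) (phi psi : {scalar ncpoly R d}).
Local Notation tC := (t%:C)%C.
Local Notation As := (ncpoly_star_word_algebra R d).

Definition preserves_lead (T : ncpoly R d -> ncpoly R d) := forall w p,
  (mmeasure (@fdeg _) (p - ncmon w) <= size w)%N ->
  (mmeasure (@fdeg _) (T p - ncmon w) <= size w)%N.

Lemma transfer_exists : phi 1 = 1 ->
  exists T : {linear ncpoly R d -> ncpoly R d},
    is_transfer ncmon tC phi T /\ preserves_lead T.
Proof.
move=> phi1; have [T T_mon] := malg_linear_ext
  (fun w : {fmonom 'I_d} => tC *: (ncmon w : ncpoly R d) + (1 - tC) *:
     \sum_(k < (size w).+1) phi (ncmon (drop k w)) *: ncmon (take k w)).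
have T_word : is_transfer ncmon tC phi T by move=> w; exact: (T_mon (FMonom w)).
exists T; split=> // w p.
apply: (@mmeasure_lead _ _ (@fdeg 'I_d) T (FMonom w)) => v.
have := @transfer_word_lead _ _ _ _ _ As _ _ _ T_word phi1 v.
rewrite /ncmon fmK => ->; apply: mmeasure_sum_lt => j.
by change (size (take j v) < size v)%N; rewrite size_take ltn_ord.
Qed.

Hypotheses (t_gt0 : 0 < t) (phi_state : is_state phi).
Hypothesis psi_power : is_boolean_power phi t psi.

Let phi1 : phi 1 = 1. Proof. by case: phi_state. Qed.
Let phi_star p : phi (ncstar p) = (phi p)^*.
Proof. by case: phi_state => _ ->. Qed.
Let tC_gt0 : 0 < tC. Proof. by rewrite ltcR. Qed.
Let psi_moments w := boolean_power_moments w phi1 psi_power.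

Lemma boolean_power_state : is_state psi.
Proof.
have [T [T_word _]] := transfer_exists phi1; case: phi_state => _ _ phi_ge0.
exact: (transfer_state As T_word phi1 tC_gt0 phi_star psi_moments phi_ge0).
Qed.

Lemma boolean_power_MOPS (T : {linear ncpoly R d -> ncpoly R d})
    (P : seq 'I_d -> ncpoly R d) :
  is_transfer ncmon tC phi T -> preserves_lead T ->
  is_MOPS phi P -> is_MOPS psi (fun u => T (P u)).
Proof.
move=> T_word T_lead [P0 P_lead P_orth]; split=> [|u|u v /eqP neq_uv].
- rewrite P0; exact: (transfer1 As T_word phi1).
- exact: T_lead.
- apply: (transfer_orthogonal As T_word phi1 tC_gt0 phi_star psi_moments P0) => //.
  by move=> ? ? /eqP; apply: P_orth.
Qed.

(** The scaled coefficients enter through equations, not as scale_level itself,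
    so that the lemma also serves to go back from psi to phi: there they are the
    given ones, equal level by level to their double rescaling. *)
Lemma boolean_power_recursion (B B' : 'I_d -> forall k, level_mx R d k)
    (C C' : forall k, level_mx R d k) :
  (forall i k, B' i k = scale_level 0 t (B i) k) ->
  (forall k, C' k = scale_level 1 t C k) ->
  recursion_coefficients phi B C -> recursion_coefficients psi B' C'.
Proof.
move=> B'E C'E [C_ge0 [P MOPS_P [rec0 rec1]]]; split=> [k k_gt0|].
  have [C_diag C_ge] := C_ge0 k k_gt0; rewrite C'E; split=> [|u].
    apply/is_diag_mxP => i j neq_ij; rewrite /scale_level.
    by case: (k == 1%N); rewrite ?mxE (is_diag_mxP C_diag) ?mulr0.
  rewrite level_entry_scale mulr_ge0 //.
  by case: (k == 1%N); rewrite ?ler01 ?(ltW tC_gt0).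
have [T [T_word T_lead]] := transfer_exists phi1.
exists (fun u => T (P u)); first exact: boolean_power_MOPS.
have [P0 _ P_orth_neq] := MOPS_P.
have P_orth u v : u <> v -> phi (ncstar (P u) * P v) = 0.
  by move/eqP; apply: P_orth_neq.
split=> [i|i k u].
  rewrite malgCE B'E level_entry_scale.
  apply: (transfer_recursion0 As T_word phi1 P0 P_orth).
  by rewrite -malgCE; apply: rec0.
have := rec1 i k u; case/tupleP: u => j u; rewrite theadE => rec_u.
(* u is the tail of a word of length k + 1, so it is empty just when the level
   k + 1 is the rescaled level 1. *)
have C'u : (i == j)%:R * level_entry (C' k.+1) [tuple of j :: u] [tuple of j :: u] =
    (if tval u is [::] then tC else 1) *
    ((i == j)%:R * level_entry (C k.+1) [tuple of j :: u] [tuple of j :: u]).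
  rewrite C'E level_entry_scale mulrCA; congr (_ * _).
  by case: k u {rec_u} => [|k] u; [rewrite tuple0 | case/tupleP: u].
rewrite C'u B'E; under eq_bigr => x _ do rewrite level_entry_scale mul1r.
apply: (transfer_recursion As T_word phi1 P0 P_orth _ rec_u) => x.
by case/tupleP: x => l x; exists l, x.
Qed.

End BooleanPowerMOPS.

Theorem corollary13 (R : realType) (d : nat) (t : R)
    (phi psi : {scalar ncpoly R d}) :
  0 < t ->
  is_state phi ->
  has_MOPS phi ->
  is_boolean_power phi t psi ->
  [/\ is_state psi,
      has_MOPS psi
    & forall (T : 'I_d -> forall k : nat, level_mx R d k)
             (C : forall k : nat, level_mx R d k),
        recursion_coefficients phi T C <->
        recursion_coefficients psi
          (fun i => scale_level 0%N t (T i)) (scale_level 1%N t C)].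
Proof.
move=> t_gt0 phi_state [P MOPS_P] psi_power.
have psi_state := boolean_power_state t_gt0 phi_state psi_power.
have phi_power : is_boolean_power psi t^-1 phi.
  split=> [|u]; first by case: phi_state.
  have [_ ->] := psi_power.
  by rewrite mulrA -rmorphM mulVf ?gt_eqF // rmorph1 mul1r.
have tV_gt0 : 0 < t^-1 by rewrite invr_gt0.
have scaleK k0 (D : forall k, level_mx R d k) k :
    D k = scale_level k0 t^-1 (scale_level k0 t D) k.
  rewrite /scale_level; case: eqP => // _.
  by rewrite scalerA -rmorphM mulVf ?gt_eqF // rmorph1 scale1r.
split; first exact: psi_state.
  have [phi1 _ _] := phi_state; have [T [T_word T_lead]] := transfer_exists t phi1.
  by exists (fun u => T (P u)); apply: boolean_power_MOPS T_word T_lead MOPS_P.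
move=> B C; split.
  exact: (boolean_power_recursion t_gt0 phi_state psi_power).
apply: (boolean_power_recursion tV_gt0 psi_state phi_power) => [i k|k].
  exact: scaleK.
exact: scaleK.
Qed.
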